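(* Let $I$ be a non-empty set and let $E\subseteq\mathbb{R}^I$ be a linear subspace containing all $e_i$ ($i\in I$), endowed with a complete absolute normalised norm $\|\cdot\|_E$ such that $\operatorname{span}\{e_i:i\in I\}$ is dense in $E$. If $E$ is URED and $(X_i)_{i\in I}$ is a family of uacsed Banach spaces, then $\bigl[\bigoplus_{i\in I}X_i\bigr]_E$ is also uacsed.
   Context: Banach spaces are real; $S_X$ denotes the unit sphere of $X$ and $X^*$ its dual. A Banach space $X$ is called - URED (uniformly rotund in every direction) if for every $z\in X\setminus\{0\}$ and all sequences $(x_n)$, $(y_n)$ in $S_X$ with $\|x_n+y_n\|\to 2$ and $x_n-y_n\in\operatorname{span}\{z\}$ for every $n$, one has $\|x_n-y_n\|\to 0$; - uacsed if for every $z\in X\setminus\{0\}$ and all sequences $(x_n)$, $(y_n)$ in $S_X$ and $(x_n^* )$ in $S_{X^*}$ with $\|x_n+y_n\|\to 2$, $x_n^*(x_n)\to 1$ and $x_n-y_n\in\operatorname{span}\{z\}$ for every $n$, one has $x_n^*(y_n)\to 1$. For a non-empty set $I$, $e_i\in\mathbb{R}^I$ denotes the characteristic function of $\{i\}$. A norm $\|\cdot\|_E$ on a subspace $E$ of $\mathbb{R}^I$ (with all $e_i\in E$) is absolute if whenever $(a_i)_{i\in I}\in E$, $(b_i)_{i\in I}\in\mathbb{R}^I$ and $|a_i|=|b_i|$ for all $i\in I$, then $(b_i)_{i\in I}\in E$ and $\|(a_i)_{i\in I}\|_E=\|(b_i)_{i\in I}\|_E$; it is normalised if $\|e_i\|_E=1$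 for every $i\in I$. For a family $(X_i)_{i\in I}$ of Banach spaces, the absolute sum with respect to $E$ is $\bigl[\bigoplus_{i\in I}X_i\bigr]_E=\{(x_i)_{i\in I}\in\prod_{i\in I}X_i:(\|x_i\|)_{i\in I}\in E\}$ with the norm $\|(x_i)_{i\in I}\|_E=\|(\|x_i\|)_{i\in I}\|_E$; it is a Banach space. *)

(* Defs.v *)
From HB Require Import structures.
From mathcomp Require Import all_boot all_order all_algebra lra.
From mathcomp Require Import all_classical all_reals all_analysis.

Set Implicit Arguments.
Unset Strict Implicit.
Unset Printing Implicit Defensive.

Import Order.TTheory GRing.Theory Num.Theory.
Import numFieldNormedType.Exports.

Local Open Scope classical_set_scope.
Local Open Scope ring_scope.

Definition lin_span (R : realType) (V : lmodType R) (A : set V) : set V :=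
  [set v | exists (n : nat) (t : 'I_n -> R) (a : 'I_n -> V),
    (forall k, A (a k)) /\ v = \sum_(k < n) t k *: a k].

Lemma lin_span1 (R : realType) (V : lmodType R) (z v : V) :
  lin_span [set z] v <-> exists t : R, v = t *: z.
Proof.
split=> [[n [t [a [az ->]]]]|[t ->]].
  exists (\sum_(k < n) t k); rewrite scaler_suml.
  by apply: eq_bigr => k _; rewrite (az k).
by exists 1%N, (fun=> t), (fun=> z); split => //; rewrite big_ord1.
Qed.

Definition unit_sphere (R : realType) (X : normedModType R) : set X :=
  [set x | `|x| = 1].

(* [sup] returns 0 on unbounded sets, so [opnorm f] is the operator norm of [f]
   only when [f] is bounded. *)
Definition opnorm (R : realType) (X : normedModType R) (f : X -> R) : R :=
  sup [set `|f x| | x in [set x : X | `|x| <= 1]].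

Definition dual_sphere (R : realType) (X : normedModType R) :
    set {linear X -> R} :=
  [set f | continuous f /\ opnorm f = 1].

Definition URED (R : realType) (X : completeNormedModType R) : Prop :=
  forall (z : X) (x y : nat -> X), z != 0 ->
    (forall n, unit_sphere (x n)) -> (forall n, unit_sphere (y n)) ->
    `|x n + y n| @[n --> \oo] --> (2 : R) ->
    (forall n, lin_span [set z] (x n - y n)) ->
    `|x n - y n| @[n --> \oo] --> (0 : R).

Definition uacsed (R : realType) (X : completeNormedModType R) : Prop :=
  forall (z : X) (x y : nat -> X) (f : nat -> {linear X -> R}), z != 0 ->
    (forall n, unit_sphere (x n)) -> (forall n, unit_sphere (y n)) ->
    (forall n, dual_sphere (f n)) ->
    `|x n + y n| @[n --> \oo] --> (2 : R) ->
    f n (x n) @[n --> \oo] --> (1 : R) ->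
    (forall n, lin_span [set z] (x n - y n)) ->
    f n (y n) @[n --> \oo] --> (1 : R).

(* [nsnorm] is total; only its values on [nscarrier] matter. *)
Record normed_subspace (R : realType) (I : Type) := NormedSubspace {
  nscarrier : {pred I -> R};
  nsnorm : (I -> R) -> R;
  nscarrier_submod : submod_closed nscarrier;
  nsnormD : {in nscarrier &, forall a b, nsnorm (a + b) <= nsnorm a + nsnorm b};
  nsnormZ : forall t : R,
    {in nscarrier, forall a, nsnorm (t *: a) = `|t| * nsnorm a};
  nsnorm0_eq0 : {in nscarrier, forall a, nsnorm a = 0 -> a = 0}
}.

Section normed_subspace_type.
Variables (R : realType) (I : Type) (E : normed_subspace R I).

HB.instance Definition _ := GRing.isSubmodClosed.Build R (I -> R)
  (nscarrier E) (nscarrier_submod E).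

Record nstype := NSType { nsval : I -> R; _ : nsval \in nscarrier E }.

HB.instance Definition _ := [isSub for nsval].
HB.instance Definition _ := [Choice of nstype by <:].
HB.instance Definition _ := [SubChoice_isSubLmodule of nstype by <:].

Let nsD (a b : nstype) :
  nsnorm E (nsval (a + b)) <= nsnorm E (nsval a) + nsnorm E (nsval b).
Proof. exact: nsnormD (valP a) (valP b). Qed.

Let nsZ (t : R) (a : nstype) :
  nsnorm E (nsval (t *: a)) = `|t| * nsnorm E (nsval a).
Proof. exact: nsnormZ (valP a). Qed.

Let ns0 (a : nstype) : nsnorm E (nsval a) = 0 -> a = 0.
Proof. by move=> a0; apply/val_inj/(nsnorm0_eq0 (valP a) a0). Qed.

HB.instance Definition _ := Lmodule_isNormed.Build R nstype nsD nsZ ns0.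

End normed_subspace_type.


Record abs_norm_space (R : realType) (I : Type) := AbsNormSpace {
  ans_base :> normed_subspace R I;
  ans_delta : forall i : I, \1_[set i] \in nscarrier ans_base;
  ans_absolute : forall a b : I -> R, a \in nscarrier ans_base ->
    (forall i, `|a i| = `|b i|) ->
    b \in nscarrier ans_base /\ nsnorm ans_base a = nsnorm ans_base b;
  ans_normalised : forall i : I, nsnorm ans_base \1_[set i] = 1;
  ans_complete : forall F : set_system (nstype ans_base),
    ProperFilter F -> cauchy F -> cvg F
}.

Definition anstype (R : realType) (I : Type) (E : abs_norm_space R I) : Type :=
  nstype E.

Section abs_norm_space_type.
Variables (R : realType) (I : Type) (E : abs_norm_space R I).

HB.instance Definition _ := NormedModule.on (anstype E).
HB.instance Definition _ :=
  Uniform_isComplete.Build (anstype E) (@ans_complete R I E).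

Definition delta (i : I) : anstype E := NSType (ans_delta E i).

End abs_norm_space_type.


Section abs_norm_space_theory.
Variables (R : realType) (I : Type) (E : abs_norm_space R I).

Lemma ans_normE (a : anstype E) : `|a| = nsnorm E (nsval a).
Proof. by []. Qed.

Lemma ans_coord_le (a : anstype E) (i : I) : `|nsval a i| <= `|a|.
Proof.
pose b j := if `[< j = i >] then - nsval a j else nsval a j.
have [bE Nb] : b \in nscarrier E /\ nsnorm E (nsval a) = nsnorm E b.
  apply: (ans_absolute (valP a)) => j.
  by rewrite /b; case: asboolP => // _; rewrite normrN.
pose B : anstype E := NSType bE.
have aB : a - B = (2 * nsval a i) *: delta E i.
  apply/val_inj/funext => j.
  suff : nsval a j - b j = 2 * nsval a i * \1_[set i] j by [].
  rewrite /b.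
  case: asboolP => [->|ji].
    have -> : \1_[set i] i = 1 :> R by rewrite indicE mem_set.
    by rewrite mulr1 opprK mulr_natl mulr2n.
  have -> : \1_[set i] j = 0 :> R by rewrite indicE memNset.
  by rewrite mulr0 subrr.
have : `|a - B| <= `|a| + `|B| by exact: ler_normB.
rewrite aB normrZ [X in _ * X](ans_normalised E i) mulr1.
have -> : `|B| = `|a| by exact/esym/Nb.
by rewrite normrM ger0_norm// -mulr2n -[leRHS]mulr_natl ler_pM2l.
Qed.

Lemma ans_cvg_coord (F : set_system (anstype E)) (l : anstype E) (i : I) :
  Filter F -> F --> l -> (nsval a i @[a --> F]) --> nsval l i.
Proof.
move=> FF Fl; apply/cvgrPdist_lt => e e0.
move/cvgrPdist_lt : Fl => /(_ e e0); apply: filterS => a /=.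
by apply: le_lt_trans; exact: (ans_coord_le (l - a)).
Qed.

(* An absolute norm on a complete space is monotone and its carrier is solid:
   a multiplier [c] with values in [-1, 1] is a series of sign functions with
   coefficients 2^-n, which converges by completeness. *)
Section dominated.
Variables (b : anstype E) (c : I -> R).
Hypothesis c1 : forall i, `|c i| <= 1.

Let sgn (x : R) : R := if 0 <= x then 1 else -1.

Let sgn1 x : `|sgn x| = 1.
Proof. by rewrite /sgn; case: ifP => _; rewrite ?normrN normr1. Qed.

Fixpoint dyadic (n : nat) (i : I) : R :=
  if n is n'.+1 then dyadic n' i + 2^-1 ^+ n * sgn (c i - dyadic n' i) else 0.

Let dyadicP n i : `|c i - dyadic n i| <= 2^-1 ^+ n.
Proof.
elim: n => [|n IH] /=; first by rewrite subr0 expr0.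
rewrite opprD addrA; move: IH; move: (c i - dyadic n i) => x.
rewrite exprS; move: (2^-1 ^+ n : R) => p xp.
have -> : 2^-1 * p * sgn x = 2^-1 * (sgn x * p) by rewrite -mulrA (mulrC p).
move: xp; rewrite ler_norml => /andP[x1 x2].
by rewrite ler_norml /sgn; case: (leP 0 x) => x0; apply/andP; split; lra.
Qed.

Let term_subproof n :
  (fun i => sgn (c i - dyadic n i) * nsval b i) \in nscarrier E /\
  nsnorm E (nsval b) =
    nsnorm E (fun i => sgn (c i - dyadic n i) * nsval b i).
Proof.
apply: (ans_absolute (valP b)) => i.
by rewrite normrM sgn1 mul1r.
Qed.

Let term n : anstype E := 2^-1 ^+ n.+1 *: NSType (term_subproof n).1.

Let norm_term n : `|term n| = 2^-1 ^+ n.+1 * `|b|.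
Proof.
rewrite normrZ ger0_norm ?exprn_ge0 ?invr_ge0//; congr (_ * _).
exact/esym/(term_subproof n).2.
Qed.

Let seriesE n i : nsval (series term n) i = dyadic n i * nsval b i.
Proof.
elim: n => [|n IH]; first by rewrite /series /= big_geq// mul0r.
rewrite seriesSr.
rewrite -[LHS]/(nsval (series term n) i + 2^-1 ^+ n.+1 *
  (sgn (c i - dyadic n i) * nsval b i)) IH /=.
by rewrite mulrDl mulrA.
Qed.

Let cvg_term : cvgn (series term).
Proof.
apply: normed_cvg.
rewrite (_ : [normed series term] = series (geometric (2^-1 * `|b|) 2^-1)).
  by apply: is_cvg_geometric_series; rewrite ger0_norm ?invr_ge0// invf_lt1 ?ltr1n.
apply/funext => n; apply: eq_bigr => k _.
by rewrite [LHS]norm_term exprS /geometric /= mulrAC.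
Qed.

Lemma ans_scaled : (fun i => c i * nsval b i) \in nscarrier E /\
  nsnorm E (fun i => c i * nsval b i) <= `|b|.
Proof.
pose l : anstype E := limn (series term).
have sl : series term @ \oo --> l by exact: cvg_term.
have lE : nsval l = (fun i => c i * nsval b i).
  apply/funext => i.
  have h1 : (fun n => nsval (series term n) i) @ \oo --> nsval l i.
    exact: (@ans_cvg_coord (series term @ \oo) l i).
  have h2 : (fun n => nsval (series term n) i) @ \oo --> c i * nsval b i.
    under eq_cvg do rewrite seriesE.
    apply: cvgMl; apply/subr_cvg0.
    apply: norm_cvg0.
    apply: (@squeeze_cvgr _ _ _ _ (cst 0) (fun n => 2^-1 ^+ n : R)).
    - by apply: nearW => n; rewrite normr_ge0 /= distrC dyadicP.
    - exact: cvg_cst.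
    - by apply: cvg_expr; rewrite ger0_norm ?invr_ge0// invf_lt1 ?ltr1n.
  exact: (cvg_unique _ h1 h2).
rewrite -lE; split; first exact: valP.
rewrite -[leLHS]/(`|l|).
have nl : (fun n => `|series term n|) @ \oo --> `|l| by exact: cvg_norm.
apply: (cvgr_to_le nl).
apply: nearW => n /=.
have : `|series term n| <= (1 - 2^-1 ^+ n) * `|b|.
  elim: n => [|n IH]; first by rewrite /series/= big_geq// normr0 expr0 subrr mul0r.
  rewrite seriesSr (le_trans (ler_normD _ _))// norm_term.
  rewrite (le_trans (lerD IH (lexx _)))// -mulrDl ler_wpM2r//.
  by rewrite exprS; lra.
move/le_trans; apply; rewrite ler_piMl//.
Qed.

End dominated.

Lemma ans_dominated (a : I -> R) (b : anstype E) :
  (forall i, `|a i| <= `|nsval b i|) ->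
  a \in nscarrier E /\ nsnorm E a <= `|b|.
Proof.
move=> ab; pose c i := a i / nsval b i.
have c1 i : `|c i| <= 1.
  rewrite /c normrM normfV.
  have [->|b0] := eqVneq (nsval b i) 0; first by rewrite normr0 invr0 mulr0.
  by rewrite ler_pdivrMr ?normr_gt0// mul1r.
have -> : a = (fun i => c i * nsval b i).
  apply/funext => i; rewrite /c.
  have [b0|b0] := eqVneq (nsval b i) 0; last by rewrite divfK.
  by apply/eqP; rewrite b0 mulr0 -normr_le0 (le_trans (ab i))// b0 normr0.
exact: ans_scaled.
Qed.

End abs_norm_space_theory.

Definition dprod (I : Type) (X : I -> Type) := forall i, X i.

Section dprod_lmod.
Variables (R : realType) (I : Type) (X : I -> completeNormedModType R).

HB.instance Definition _ := Choice.copy (dprod X) (forall i, X i).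

Let addA : associative (fun x y : dprod X => (fun i => x i + y i) : dprod X).
Proof. by move=> x y z; apply/functional_extensionality_dep => i; rewrite addrA. Qed.
Let addC : commutative (fun x y : dprod X => (fun i => x i + y i) : dprod X).
Proof. by move=> x y; apply/functional_extensionality_dep => i; rewrite addrC. Qed.
Let add0 : left_id ((fun i => 0) : dprod X) (fun x y => (fun i => x i + y i)).
Proof. by move=> x; apply/functional_extensionality_dep => i; rewrite add0r. Qed.
Let addN : left_inverse ((fun i => 0) : dprod X) (fun x => (fun i => - x i))
  (fun x y => (fun i => x i + y i)).
Proof. by move=> x; apply/functional_extensionality_dep => i; rewrite addNr. Qed.

HB.instance Definition _ :=
  GRing.isZmodule.Build (dprod X) addA addC add0 addN.

Let scale (t : R) (x : dprod X) : dprod X := fun i => t *: x i.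
Let scaleA (s t : R) x : scale s (scale t x) = scale (s * t) x.
Proof. by apply/functional_extensionality_dep => i; rewrite /scale scalerA. Qed.
Let scale1 : left_id 1 scale.
Proof. by move=> x; apply/functional_extensionality_dep => i; rewrite /scale scale1r. Qed.
Let scaleDr : right_distributive scale +%R.
Proof. by move=> t x y; apply/functional_extensionality_dep => i; rewrite /scale scalerDr. Qed.
Let scaleDl x : {morph scale^~ x : s t / s + t}.
Proof. by move=> s t; apply/functional_extensionality_dep => i; rewrite /scale scalerDl. Qed.

HB.instance Definition _ :=
  GRing.Zmodule_isLmodule.Build R (dprod X) scaleA scale1 scaleDr scaleDl.

End dprod_lmod.

Section abs_sum.
Variables (R : realType) (I : Type) (E : abs_norm_space R I).
Variable X : I -> completeNormedModType R.

Definition norms (x : dprod X) : I -> R := fun i => `|x i|.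

Definition abs_sum_carrier : {pred dprod X} :=
  fun x => norms x \in nscarrier E.

Let norms_dom (x : dprod X) (b : anstype E) : (forall i, `|x i| <= nsval b i) ->
  norms x \in nscarrier E /\ nsnorm E (norms x) <= `|b|.
Proof.
move=> xb; apply: ans_dominated => i.
by rewrite normr_id (le_trans (xb i))// ler_norm.
Qed.

Lemma abs_sum_submod : submod_closed abs_sum_carrier.
Proof.
split; first by apply: (norms_dom (b := 0) _).1 => i; rewrite normr0.
move=> t x y xE yE.
pose b : anstype E := `|t| *: (NSType xE : anstype E) + (NSType yE : anstype E).
apply: (norms_dom (b := b) _).1 => i.
rewrite -[leRHS]/(`|t| * `|x i| + `|y i|) -normrZ.
exact: ler_normD.
Qed.

HB.instance Definition _ := GRing.isSubmodClosed.Build R (dprod X)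
  abs_sum_carrier abs_sum_submod.

Record abs_sum := AbsSum { asval : dprod X; _ : asval \in abs_sum_carrier }.

HB.instance Definition _ := [isSub for asval].
HB.instance Definition _ := [Choice of abs_sum by <:].
HB.instance Definition _ := [SubChoice_isSubLmodule of abs_sum by <:].

Definition asnorm (x : abs_sum) : R := nsnorm E (norms (asval x)).

Let nrm (x : abs_sum) : anstype E := NSType (valP x).

Let asD (x y : abs_sum) : asnorm (x + y) <= asnorm x + asnorm y.
Proof.
apply: le_trans (ler_normD (nrm x) (nrm y)).
by apply: (norms_dom (b := nrm x + nrm y) _).2 => i; exact: ler_normD.
Qed.

Let asZ (t : R) (x : abs_sum) : asnorm (t *: x) = `|t| * asnorm x.
Proof.
have -> : `|t| * asnorm x = `| `|t| *: nrm x | by rewrite normrZ normr_id.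
rewrite -[RHS]/(nsnorm E (fun i => `|t| * `|asval x i|)); congr nsnorm.
by apply/funext => i; exact: normrZ.
Qed.

Let as0 (x : abs_sum) : asnorm x = 0 -> x = 0.
Proof.
move=> /(nsnorm0_eq0 (valP x)) x0; apply: val_inj.
apply/functional_extensionality_dep => i; apply/eqP; rewrite -normr_eq0.
by apply/eqP; exact: (congr1 (fun a => a i) x0).
Qed.

HB.instance Definition _ := Lmodule_isNormed.Build R abs_sum asD asZ as0.

Lemma abs_sum_normE (x : abs_sum) :
  `|x| = nsnorm E (fun i => `|asval x i|).
Proof. by []. Qed.

Let coord_le (x : abs_sum) i : `|asval x i| <= `|x|.
Proof. by have := ans_coord_le (nrm x) i; rewrite [X in X <= _]normr_id. Qed.

Let cauchy_image (V : completeNormedModType R) (h : abs_sum -> V)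
    (F : set_system abs_sum) : ProperFilter F -> cauchy F ->
  (forall x y, `|h x - h y| <= `|x - y|) -> cvg (h @ F).
Proof.
move=> FF /cauchy_ballP Fc hl; apply: cauchy_cvg; apply/cauchy_ballP => e e0.
have := Fc e e0; case=> -[A B] /= [FA FB] AB.
exists (h @` A, h @` B) => /=.
  by split; [apply: filterS FA|apply: filterS FB] => x; exists x.
move=> [_ _] /= [[x Ax <-] [y By <-]].
have := AB (x, y) (conj Ax By); rewrite -!ball_normE /=.
exact: le_lt_trans (hl x y).
Qed.

Lemma abs_sum_complete (F : set_system abs_sum) :
  ProperFilter F -> cauchy F -> cvg F.
Proof.
move=> FF Fc.
have Fcoord i : cvg (asval x i @[x --> F]).
  by apply: cauchy_image => // x y; exact: (coord_le (x - y)).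
pose l : dprod X := fun i => lim (asval x i @[x --> F]).
have Fdist (u : abs_sum) : exists2 m : anstype E,
    nrm (u - x) @[x --> F] --> m & nsval m = norms (asval u - l).
  have /cvg_ex[m Fm] : cvg (nrm (u - x) @[x --> F]).
    apply: cauchy_image => // x y.
    apply: (ans_dominated (b := nrm (x - y)) _).2 => i.
    rewrite /= [leRHS]normr_id.
    apply: le_trans (ler_dist_dist _ _) _ => /=.
    by rewrite /= distrC opprD addrACA subrr add0r opprK addrC distrC.
  exists m => //; apply/funext => i.
  have h1 : (fun x => `|asval u i - asval x i|) @ F --> nsval m i.
    exact: (@ans_cvg_coord _ _ _ ((fun x => nrm (u - x)) @ F)).
  have h2 : (fun x => `|asval u i - asval x i|) @ F --> `|asval u i - l i|.
    by apply: cvg_norm; apply: cvgB; [exact: cvg_cst|exact: Fcoord].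
  exact: (cvg_unique _ h1 h2).
have lE : l \in abs_sum_carrier.
  have [m _ mE] := Fdist 0.
  apply: (norms_dom (b := m) _).1 => i.
  by rewrite mE -[leRHS]/(`|0 - l i|) sub0r normrN.
apply/cvg_ex; exists (AbsSum lE).
apply/cvgrPdist_le => e e0.
move/cauchy_ballP : Fc => /(_ e e0)[[A B] /= [FA FB] AB].
apply: filterS FA => x Ax.
have [m xm mE] := Fdist x.
rewrite distrC.
have -> : `|x - AbsSum lE| = `|m|.
  by rewrite -[RHS]/(nsnorm E (nsval m)) mE.
have nm : (fun y => `|nrm (x - y)|) @ F --> `|m| by exact: cvg_norm.
apply: (cvgr_to_le nm).
apply: filterS FB => y By.
have := AB (x, y) (conj Ax By); rewrite -ball_normE /=.
exact: ltW.
Qed.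

HB.instance Definition _ := Uniform_isComplete.Build abs_sum abs_sum_complete.

End abs_sum.

(* Main.v *)
From HB Require Import structures.
Require Import Defs.
From mathcomp Require Import all_boot all_order all_algebra.
From mathcomp Require Import ring lra.
From mathcomp Require Import all_classical all_reals all_analysis.

Set Implicit Arguments.
Unset Strict Implicit.
Unset Printing Implicit Defensive.

(** Let [x n], [y n] be unit vectors of the sum with [x n - y n = t n *: z] and
    [`|x n + y n|] tending to 2, and let [f n] be norm one functionals with
    [f n (x n)] tending to 1.  The claim is that [t n * f n z] tends to 0.

    Since the finitely supported families are dense and [t n], [f n] stay
    bounded, it suffices to treat one coordinate [z i] at a time.  There are two
    ingredients.

    - In [E], the families of norms of [x n] and of the midpoint
      [m n = (x n + y n) / 2] are nearly extremal, and their difference is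
      dominated by a fixed multiple of the family of norms of [z].  Density of
      the finitely supported families makes order intervals of [E] norm compact
      ([order_interval_compact]), and on a compact set of differences the
      directional condition URED becomes uniform ([URED_order_interval]).
      Hence the norms of the [i]-th coordinates of [x n] and [m n] become equal
      in the limit, and likewise for [y n] ([coordinate_midpoints]).

    - In [X i], the restriction of [f n] to the [i]-th coordinate nearly attains
      its norm at the [i]-th coordinate of [x n]: replacing this coordinate by a
      vector which is not longer would otherwise push [f n] above 1 in the unit
      ball of the sum.  If the coordinate and the restricted functional are both
      bounded away from 0, they can be normalised and the hypothesis on [X i]
      applies; if one of them is small there is nothing to prove
      ([uacsed_unnormalised]).

    In both places the pairs of vectors that arise lie in the unit ball, have a
    sum of norm near 2, but are not of norm one.  A chord of the ball that is not
    too short can be prolonged in both directions to the sphere while staying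
    nearly extremal ([extend_chord]); this turns both definitions into statements
    about the ball ([URED_near], [uacsed_ball]). *)

Import Order.TTheory GRing.Theory Num.Theory.
Import numFieldNormedType.Exports.

Local Open Scope classical_set_scope.
Local Open Scope ring_scope.

(** * Prolonging chords of the unit ball *)

Section chords.
Variables (R : realType) (X : normedModType R).

Lemma reach_unit_sphere (p w : X) : `|p| <= 1 -> w != 0 ->
  exists2 s : R, 0 <= s & `|p + s *: w| = 1.
Proof.
move=> p1 w0; have nw0 : 0 < `|w| by rewrite normr_gt0.
pose f (s : R) := `|p + s *: w|.
have f0 : f 0 <= 1 by rewrite /f scale0r addr0.
have f1 : 1 <= f (2 / `|w|).
  have -> : f (2 / `|w|) = `|(2 / `|w|) *: w - (- p)| by rewrite /f opprK addrC.
  apply: le_trans (lerB_dist _ _); rewrite normrN normrZ gtr0_norm ?divr_gt0//.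
  by rewrite divfK ?gt_eqF//; lra.
have [s] : exists2 s, s \in `[0, 2 / `|w|]%R & f s = 1.
  apply: IVT.
  - by rewrite divr_ge0.
  - apply: continuous_subspaceT => s; rewrite /f.
    apply: cvg_norm; apply: cvgD; [exact: cvg_cst|].
    by apply: cvgZl; exact: cvg_id.
  - by rewrite ge_min le_max f0 f1 orbT.
by rewrite in_itv /= => /andP[s0 _] fs; exists s.
Qed.

(** Put [c = 1 + s + r], the factor by which the chord grows.  Expanding [p + q]
    in the endpoints [p'], [q'] gives
    [c *: (p + q) = (p' + q') + (2 * r) *: p' + (2 * s) *: q'], so the defect
    from 2 is multiplied by at most [c]; and [c] is bounded as soon as the chord
    is not too short, because [p' - q'] has norm at most 2. *)
Lemma extend_chord (p q : X) : `|p| <= 1 -> `|q| <= 1 -> p != q ->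
  exists s r : R, let p' := p + s *: (p - q) in let q' := q - r *: (p - q) in
  [/\ 0 <= s, 0 <= r, unit_sphere p', unit_sphere q' &
   [/\ (1 + s + r) *: p = (1 + r) *: p' + s *: q',
       (1 + s + r) *: q = r *: p' + (1 + s) *: q',
       p' - q' = (1 + s + r) *: (p - q) &
   2 - `|p' + q'| <= (1 + s + r) * (2 - `|p + q|)]].
Proof.
move=> p1 q1 pq.
have w0 : p - q != 0 by rewrite subr_eq0.
have [s s0 ps] := reach_unit_sphere p1 w0.
have [r r0 qr] : exists2 r : R, 0 <= r & `|q - r *: (p - q)| = 1.
  have w0' : q - p != 0 by rewrite subr_eq0 eq_sym.
  have [r r0 qr] := reach_unit_sphere q1 w0'.
  by exists r => //; rewrite -scalerN opprB.
exists s, r => p' q'.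
have p'E : p' = q + (1 + s) *: (p - q).
  by rewrite scalerDl scale1r addrA addrCA subrr addr0.
have q'E : q' = q + (- r) *: (p - q) by rewrite scaleNr.
have pE : p = q + 1 *: (p - q) by rewrite scale1r addrC subrK.
have qE : q = q + 0 *: (p - q) by rewrite scale0r addr0.
(* Both identities compare coefficients of q and p - q. *)
have Ep : (1 + s + r) *: p = (1 + r) *: p' + s *: q'.
  rewrite p'E q'E {1}pE; move: (p - q) => w.
  rewrite !scalerDr !scalerA addrACA -!scalerDl.
  by congr (_ *: _ + _ *: _); ring.
have Eq : (1 + s + r) *: q = r *: p' + (1 + s) *: q'.
  rewrite p'E q'E {1}qE; move: (p - q) => w.
  rewrite !scalerDr !scalerA addrACA -!scalerDl.
  by congr (_ *: _ + _ *: _); ring.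
split => //; split => //.
  rewrite p'E q'E; move: (p - q) => w.
  rewrite opprD addrACA subrr add0r -scalerBl.
  by congr (_ *: _); ring.
have E : (1 + s + r) * `|p + q| <= (1 + s + r) * 2 - (2 - `|p' + q'|).
  have c0 : 0 <= 1 + s + r by rewrite !addr_ge0.
  rewrite -[X in X * `|_|](ger0_norm c0) -normrZ scalerDr Ep Eq.
  have -> : (1 + r) *: p' + s *: q' + (r *: p' + (1 + s) *: q') =
    (p' + q') + ((r + r) *: p' + (s + s) *: q').
    rewrite -[p' + q']scale1r [1 *: _]scalerDr [LHS]addrACA.
    rewrite [RHS]addrACA -!scalerDl.
    by congr (_ *: _ + _ *: _); ring.
  apply: (le_trans (ler_normD _ _)).
  have : `|(r + r) *: p' + (s + s) *: q'| <= 2 * r + 2 * s.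
    apply: (le_trans (ler_normD _ _)).
    by rewrite !normrZ ps qr !ger0_norm ?addr_ge0//; lra.
  lra.
lra.
Qed.

End chords.

(** * URED and uacsed with moduli *)

Section moduli.
Variables (R : realType) (X : completeNormedModType R).

Lemma cvg_harmonic_squeeze (u : nat -> R) (l : R) :
  (forall n, l - harmonic n <= u n <= l) -> u n @[n --> \oo] --> l.
Proof.
move=> ul; apply: (@squeeze_cvgr _ _ _ _ (fun n => l - harmonic n) (cst l)).
- by apply: nearW.
- rewrite -[X in _ --> X]subr0.
  by apply: cvgB; [exact: cvg_cst|exact: cvg_harmonic].
- exact: cvg_cst.
Qed.

Lemma sphere_add_le2 (x y : X) :
  unit_sphere x -> unit_sphere y -> `|x + y| <= 2.
Proof. by move=> x1 y1; rewrite (le_trans (ler_normD _ _))// x1 y1. Qed.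

Lemma URED_modulus (z : X) (e : R) : URED X -> z != 0 -> 0 < e ->
  exists2 d : R, 0 < d & forall x y : X, unit_sphere x -> unit_sphere y ->
    (exists t, x - y = t *: z) -> 2 - d <= `|x + y| -> `|x - y| < e.
Proof.
move=> UX z0 e0; apply: contrapT => no_modulus.
have /choice[u uP] n : exists u : X * X,
  [/\ unit_sphere u.1, unit_sphere u.2, exists t, u.1 - u.2 = t *: z,
      2 - harmonic n <= `|u.1 + u.2| & e <= `|u.1 - u.2|].
  apply: contrapT => nou; apply: no_modulus.
  exists (harmonic n) => [|x y x1 y1 t xy]; first exact: harmonic_gt0.
  by rewrite ltNge; apply/negP => exy; apply: nou; exists (x, y).
have cvg0 : `|(u n).1 - (u n).2| @[n --> \oo] --> (0 : R).
  apply: (UX z) => // [n|n||n].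
  - by have [] := uP n.
  - by have [] := uP n.
  - apply: cvg_harmonic_squeeze => n; have [x1 y1 _ -> _] := uP n.
    exact: sphere_add_le2.
  - by have [_ _ ? _ _] := uP n; apply/lin_span1.
suff : e <= 0 by rewrite leNgt e0.
by apply: (cvgr_to_ge cvg0); apply: nearW => n; have [] := uP n.
Qed.

Lemma dual_sphere_le (f : {linear X -> R}) :
  dual_sphere f -> forall v, `|f v| <= `|v|.
Proof.
case=> _ f1 v.
have hs : has_sup [set `|f x| | x in [set x : X | `|x| <= 1]].
  apply: contrapT => /sup_out.
  by rewrite -/(opnorm f) f1 => /eqP; rewrite oner_eq0.
have [->|v0] := eqVneq v 0; first by rewrite linear0 !normr0.
have nv0 : 0 < `|v| by rewrite normr_gt0.
have : `|f (`|v|^-1 *: v)| <= 1.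
  rewrite -f1; apply: ub_le_sup; first exact: hs.2.
  by exists (`|v|^-1 *: v) => //=; rewrite normrZ normfV normr_id mulVf ?gt_eqF.
by rewrite linearZ /= normrM normfV normr_id mulrC ler_pdivrMr// mul1r.
Qed.

Lemma uacsed_modulus (z : X) (e : R) : uacsed X -> z != 0 -> 0 < e ->
  exists2 d : R, 0 < d & forall (x y : X) (f : {linear X -> R}),
    unit_sphere x -> unit_sphere y -> dual_sphere f ->
    (exists t, x - y = t *: z) -> 2 - d <= `|x + y| -> 1 - d <= f x ->
    1 - e < f y.
Proof.
move=> UX z0 e0; apply: contrapT => no_modulus.
have /choice[u uP] n : exists u : X * X * {linear X -> R},
  [/\ unit_sphere u.1.1, unit_sphere u.1.2, dual_sphere u.2 &
     [/\ exists t, u.1.1 - u.1.2 = t *: z, 2 - harmonic n <= `|u.1.1 + u.1.2|,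
        1 - harmonic n <= u.2 u.1.1 & u.2 u.1.2 <= 1 - e]].
  apply: contrapT => nou; apply: no_modulus.
  exists (harmonic n) => [|x y f x1 y1 f1 t xy fx]; first exact: harmonic_gt0.
  by rewrite ltNge; apply/negP => exy; apply: nou; exists ((x, y), f).
have cvg1 : (u n).2 (u n).1.2 @[n --> \oo] --> (1 : R).
  apply: (UX z (fun n => (u n).1.1)) => // [n|n|n|||n].
  - by have [] := uP n.
  - by have [] := uP n.
  - by have [] := uP n.
  - apply: cvg_harmonic_squeeze => n; have [x1 y1 _ [_ -> _ _]] := uP n.
    exact: sphere_add_le2.
  - apply: cvg_harmonic_squeeze => n; have [x1 y1 f1 [_ _ -> _]] := uP n.
    by rewrite (le_trans (ler_norm _))// (le_trans (dual_sphere_le f1 _))// x1.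
  - by have [_ _ _ [? _ _ _]] := uP n; apply/lin_span1.
suff : 1 <= 1 - e by lra.
by apply: (cvgr_to_le cvg1); apply: nearW => n; have [_ _ _ []] := uP n.
Qed.

(** Not only the norms but also the difference [p - q] may deviate slightly from
    what URED prescribes; this openness in the direction is what a compactness
    argument over directions needs. *)
Lemma URED_near (z : X) : URED X -> z != 0 ->
  exists2 d : R, 0 < d & forall p q : X, `|p| <= 1 -> `|q| <= 1 ->
    `|p - q - z| < d -> `|p + q| < 2 - d.
Proof.
move=> UX z0; have nz0 : 0 < `|z| by rewrite normr_gt0.
have [d d0 dP] := URED_modulus UX z0 (divr_gt0 nz0 (@ltr0Sn R 1)).
(* The prolonged chord is longer than the given one by a factor [c] with
   [c * `|z| <= 4], and its defect is at most [c * (4 * e)]. *)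
pose e := Num.min 1 (d * `|z| / 16).
have e0 : 0 < e by rewrite lt_min ltr01 divr_gt0// mulr_gt0.
have e1 : e <= 1 by rewrite ge_min lexx.
have ed : 16 * e <= d * `|z| by rewrite mulrC -ler_pdivlMr// ge_min lexx orbT.
exists e => // p q p1 q1 pqz; rewrite ltNge; apply/negP => pq2.
pose m := 1 + e; have m0 : 0 < m by rewrite /m; lra.
(* [q] is moved by less than [e] to make the difference exactly [z]; dividing
   by [m] brings the pair back into the ball. *)
pose p1' := m^-1 *: p; pose q1' := m^-1 *: (p - z).
have pz : `|p - z| <= m.
  have -> : p - z = q + (p - q - z)
    by rewrite [p - q - z]addrAC [RHS]addrC subrK.
  by rewrite (le_trans (ler_normD _ _))// lerD// ltW.
have ball_scale (v : X) : `|v| <= m -> `|m^-1 *: v| <= 1.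
  by move=> vm; rewrite normrZ gtr0_norm ?invr_gt0// mulrC ler_pdivrMr// mul1r.
have P1 : `|p1'| <= 1 by apply: ball_scale; rewrite /m; lra.
have Q1 : `|q1'| <= 1 by exact: ball_scale.
have PQ : p1' - q1' = m^-1 *: z by rewrite -scalerBr opprB addrCA subrr addr0.
have PQ0 : p1' != q1' by rewrite -subr_eq0 PQ scaler_eq0 invr_eq0 gt_eqF.
have PQz : `|z| / 2 <= `|p1' - q1'|.
  rewrite PQ normrZ gtr0_norm ?invr_gt0// [leRHS]mulrC ler_pM2l//.
  by rewrite lef_pV2 ?posrE// /m; lra.
have S : 2 - 4 * e <= `|p1' + q1'|.
  rewrite -scalerDr normrZ gtr0_norm ?invr_gt0// [leRHS]mulrC ler_pdivlMr//.
  have : `|p + q| - e <= `|p + (p - z)|.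
    have -> : p + q = p + (p - z) - (p - q - z).
      by rewrite [p - q - z]addrAC opprB addrACA subrr addr0.
    by rewrite lerBlDr (le_trans (ler_normB _ _))// lerD2l ltW.
  rewrite /m; nra.
have [s [r /= [s0 r0 x1 y1 [_ _ xy xy2]]]] := extend_chord P1 Q1 PQ0.
set x := p1' + _ in x1 xy xy2; set y := q1' - _ in y1 xy xy2.
pose c := 1 + s + r; have c1 : 1 <= c by rewrite /c; lra.
have nxy : c * `|p1' - q1'| = `|x - y|.
  by rewrite xy normrZ ger0_norm// (le_trans _ c1).
have xyd : `|x - y| < `|z| / 2.
  apply: dP => //; first by exists (c / m); rewrite xy PQ scalerA.
  have : c * `|z| <= 4.
    have : `|x - y| <= 2 by rewrite (le_trans (ler_normB _ _))// x1 y1.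
    rewrite -nxy; nra.
  rewrite -/c in xy2; nra.
have : `|p1' - q1'| <= `|x - y| by rewrite -nxy ler_peMl.
lra.
Qed.

End moduli.

(** * Compactness of order intervals *)

Lemma fmap_ultra (T U : Type) (f : T -> U) (F : set_system T) :
  UltraFilter F -> UltraFilter (f @ F).
Proof.
move=> FU; split=> [|G GF FG]; first exact: fmap_proper_filter.
apply/seteqP; split=> [A GA|]; last exact: FG.
have [//|FnA] := in_ultra_setVsetC (f @^-1` A) FU.
have : G (A `&` ~` A) by apply: filterI => //; exact: FG.
by rewrite setICr => /filter_not_empty.
Qed.

Section order_intervals.
Variables (R : realType) (I : Type) (E : abs_norm_space R I).
Hypothesis spanE : dense (lin_span (range (delta E))).

Lemma nsval_sum (J : Type) (s : seq J) (a : J -> anstype E) i :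
  nsval (\sum_(j <- s) a j) i = \sum_(j <- s) nsval (a j) i.
Proof. exact: (big_morph (fun b : anstype E => nsval b i)). Qed.

Lemma ans_finsupp_le (s : seq {classic I}) (a : anstype E) :
  (forall i : {classic I}, i \notin s -> nsval a i = 0) ->
  `|a| <= \sum_(i <- s) `|nsval a i|.
Proof.
move=> a0; pose b : anstype E := \sum_(i <- s) `|nsval a i| *: delta E i.
have ab : `|a| <= `|b|.
  apply: (ans_dominated (b := b) _).2 => j.
  have bj : nsval b j = \sum_(i <- s) `|nsval a i| * \1_[set i] j.
    by rewrite nsval_sum.
  rewrite bj [leRHS]ger0_norm; last by apply: sumr_ge0 => i _; rewrite mulr_ge0.
  have [js|js] := boolP ((j : {classic I}) \in s); last first.
    by rewrite a0// normr0; apply: sumr_ge0 => i _; rewrite mulr_ge0.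
  rewrite (big_rem _ js) /= indicE mem_set// mulr1 lerDl.
  by apply: sumr_ge0 => i _; rewrite mulr_ge0.
rewrite (le_trans ab)// (le_trans (ler_norm_sum _ _ _))//.
apply: ler_sum => i _.
by rewrite normrZ normr_id [X in _ * X](ans_normalised E i) mulr1.
Qed.

(** Outside the support of a finitely supported [v] close to [w], the family [w]
    coincides with [w - v], and an absolute norm is monotone. *)
Lemma ans_small_tail (w : anstype E) (e : R) : 0 < e ->
  exists s : seq {classic I}, forall a : anstype E,
    (forall i, `|nsval a i| <= `|nsval w i|) ->
    (forall i : {classic I}, i \in s -> nsval a i = 0) -> `|a| < e.
Proof.
move=> e0.
have [v [/= wv [n [t [u [u_delta vE]]]]]] :
    ball w e `&` lin_span (range (delta E)) !=set0.
  apply: spanE; last exact: ball_open.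
  by exists w; exact: ballxx.
have /choice[idx idxE] k : exists i, u k = delta E i.
  by have [i _ <-] := u_delta k; exists i.
pose s := [seq (idx k : {classic I}) | k <- enum 'I_n].
exists s => a aw a0.
have : `|w - v| < e by move: wv; rewrite -ball_normE.
apply: le_lt_trans; apply: (ans_dominated (b := w - v) _).2 => i.
have [iS|iS] := boolP ((i : {classic I}) \in s).
  by rewrite a0// normr0.
suff vi : nsval v i = 0.
  by rewrite -[nsval (w - v) i]/(nsval w i - nsval v i) vi subr0.
rewrite vE nsval_sum big1// => k _.
rewrite idxE -[LHS]/(t k * \1_[set idx k] i) indicE memNset ?mulr0//= => ik.
by move/mapP: iS; apply; exists k => //; rewrite mem_enum.
Qed.

(** Coordinatewise limits along an ultrafilter exist by compactness of segments;
    as all tails are dominated by the small tail of [w], the convergence is one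
    in norm. *)
Lemma order_interval_compact (w : anstype E) :
  compact [set a : anstype E | forall i, `|nsval a i| <= `|nsval w i|].
Proof.
rewrite compact_ultra => F FU Fw.
have /choice[l lP] i : exists x : R,
    `|x| <= `|nsval w i| /\ nsval a i @[a --> F] --> x.
  have := @segment_compact R (- `|nsval w i|) (`|nsval w i|).
  rewrite compact_ultra => /(_ (nsval a i @[a --> F]) (fmap_ultra _ FU)).
  case=> [|x [xw Fx]].
    change (F [set a | nsval a i \in `[- `|nsval w i|, `|nsval w i|]]).
    by apply: filterS Fw => a /(_ i) aw /=; rewrite in_itv /= -ler_norml.
  by exists x; split=> //; move: xw => /=; rewrite in_itv /= -ler_norml.
have lE := (ans_dominated (b := w) (fun i => (lP i).1)).1.
pose L : anstype E := NSType lE.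
exists L; split; first by move=> i; exact: (lP i).1.
apply/cvgrPdist_lt => e e0.
have e4 : 0 < e / 4 by rewrite divr_gt0.
have [s sP] := ans_small_tail w e4.
pose d := e / 4 / (size s).+1%:R; have d0 : 0 < d by rewrite divr_gt0.
have Fs : \forall a \near F, forall i : {classic I}, i \in s ->
    `|l i - nsval a i| < d.
  move: d d0 => d d0; elim: {sP} s => [|i s IH]; first by apply: nearW => a i.
  have Fi : \forall a \near F, `|l i - nsval a i| < d.
    by move/cvgrPdist_lt : (lP i).2; apply.
  apply: filterS2 Fi IH => a ai IH j; rewrite in_cons => /orP[/eqP ->//|].
  exact: IH.
near=> a.
have aw : forall i, `|nsval a i| <= `|nsval w i| by near: a; exact: Fw.
have as_ : forall i : {classic I}, i \in s -> `|l i - nsval a i| < d.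
  by near: a.
pose u i := if (i : {classic I}) \in s then l i - nsval a i else 0.
(* The factor 1/2 keeps the tail of [l - a] below [w]. *)
pose v i := if (i : {classic I}) \in s then 0 else 2^-1 * (l i - nsval a i).
have uE : u \in nscarrier E.
  apply: (ans_dominated (b := L - a) _).1 => i.
  by rewrite /u; case: ifP => // _; rewrite normr0.
have vw i : `|v i| <= `|nsval w i|.
  rewrite /v; case: ifP => _; first by rewrite normr0.
  rewrite normrM ger0_norm ?invr_ge0//.
  have := ler_normB (l i) (nsval a i); have := aw i; have := (lP i).1; lra.
have vE := (ans_dominated vw).1.
pose U : anstype E := NSType uE; pose V : anstype E := NSType vE.
have -> : L - a = U + 2 *: V.
  apply/val_inj/funext => i.
  rewrite -[LHS]/(l i - nsval a i) -[RHS]/(u i + 2 * v i) /u /v.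
  by case: ifP => _; rewrite ?mulr0 ?addr0// add0r mulrA mulfV ?mul1r.
have Ve : `|V| < e / 4 by apply: sP => //= i si; rewrite /v si.
have Ue : `|U| <= e / 4.
  apply: le_trans (@ans_finsupp_le s U _) _ => /= [i /negbTE si|].
    by rewrite /u si.
  apply: (@le_trans _ _ (\sum_(i <- s) d)).
    rewrite big_seq [leRHS]big_seq; apply: ler_sum => i si.
    by rewrite /u si ltW// as_.
  rewrite big_const_seq count_predT iter_addr_0.
  have -> : e / 4 = d *+ (size s).+1 by rewrite -[RHS]mulr_natr divfK.
  by rewrite ler_wpMn2l ?ltW.
apply: le_lt_trans (ler_normD _ _) _; rewrite normrZ ger0_norm//; lra.
Unshelve. all: by end_near. Qed.

(** Each possible limit [x] of the differences [a - b] has, by [URED_near], a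
    neighbourhood and a defect that exclude nearly extremal pairs, unless
    [x = 0]; compactness makes the defect independent of [x]. *)
Lemma URED_order_interval (w : anstype E) (e : R) : URED (anstype E) -> 0 < e ->
  exists2 d : R, 0 < d & forall a b : anstype E, `|a| <= 1 -> `|b| <= 1 ->
    (forall i, `|nsval a i - nsval b i| <= `|nsval w i|) ->
    2 - d <= `|a + b| -> `|a - b| < e.
Proof.
move=> UE e0.
have /compact_near_coveringP/(_ _ 0^'+
  (fun d x => forall a b : anstype E, `|a| <= 1 -> `|b| <= 1 -> x = a - b ->
     2 - d <= `|a + b| -> `|a - b| < e)) := @order_interval_compact w.
have pf : Filter (0^'+ : set_system R) by exact: at_right_proper_filter.
move=> /(_ pf) near_cover.
have /near_cover : forall x : anstype E,
    (forall i, `|nsval x i| <= `|nsval w i|) ->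
  \forall y \near x & d \near 0^'+, forall a b : anstype E,
    `|a| <= 1 -> `|b| <= 1 -> y = a - b -> 2 - d <= `|a + b| -> `|a - b| < e.
  move=> x _; have [->|x0] := eqVneq x 0.
    exists (ball 0 e, setT) => /=.
      by split; [exact: nbhsx_ballx|exact: filterT].
    move=> [y d] /= [] + _ a b _ _ yE _.
    by rewrite -ball_normE /= sub0r normrN yE.
  have [d d0 dP] := URED_near UE x0.
  exists (ball x d, [set d' | d' < d]) => /=.
    by split; [exact: nbhsx_ballx|exact: nbhs_right_lt].
  move=> [y d'] /= [] + d'd a b a1 b1 yE ab2.
  rewrite -ball_normE /= yE distrC => abx.
  have := dP a b a1 b1 abx; lra.
move=> near_d.
have [d [d0 dP]] : exists d : R, 0 < d /\ forall x : anstype E,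
    (forall i, `|nsval x i| <= `|nsval w i|) ->
    forall a b : anstype E, `|a| <= 1 -> `|b| <= 1 -> x = a - b ->
     2 - d <= `|a + b| -> `|a - b| < e.
  apply: (@filter_ex _ (0^'+ : set_system R)).
  apply: filterI; [exact: nbhs_right_gt|exact: near_d].
by exists d => // a b a1 b1 ab; exact: (dP (a - b)).
Qed.

End order_intervals.

(** * Functionals and uacsed spaces *)

Section functionals.
Variables (R : realType) (X : completeNormedModType R).

Lemma opnorm_le (f : X -> R) (k : R) :
  (forall v, `|v| <= 1 -> `|f v| <= k) -> opnorm f <= k.
Proof.
move=> fk; apply: sup_le_ub; first by exists `|f 0|, 0 => //=; rewrite normr0.
by move=> _ [v v1 <-]; exact: fk.
Qed.

Lemma opnorm_ge0 (f : X -> R) : 0 <= opnorm f.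
Proof.
set A := [set `|f x| | x in [set x : X | `|x| <= 1]].
have f0 : A `|f 0| by exists 0 => //=; rewrite normr0.
have [hs|/sup_out h0] := pselect (has_sup A).
  by apply: le_trans (normr_ge0 (f 0)) _; apply: ub_le_sup f0; exact: hs.2.
by rewrite /opnorm -/A h0.
Qed.

Lemma contraction_opnorm (f : {linear X -> R}) :
  (forall v, `|f v| <= `|v|) -> forall v, `|f v| <= opnorm f * `|v|.
Proof.
move=> f1 v; have [->|v0] := eqVneq v 0; first by rewrite linear0 !normr0 mulr0.
have nv0 : 0 < `|v| by rewrite normr_gt0.
rewrite -ler_pdivrMr//.
have -> : `|f v| / `|v| = `|f (`|v|^-1 *: v)|.
  by rewrite linearZ /= normrM normfV normr_id mulrC.
apply: ub_le_sup; last first.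
  by exists (`|v|^-1 *: v) => //=; rewrite normrZ normfV normr_id mulVf ?gt_eqF.
by exists 1 => _ [u u1 <-]; exact: le_trans (f1 u) u1.
Qed.

Lemma normalise_dual (g : {linear X -> R}) :
  (forall v, `|g v| <= `|v|) -> 0 < opnorm g ->
  exists2 h : {linear X -> R}, dual_sphere h & forall v, g v = opnorm g * h v.
Proof.
move=> g1 N0; set N := opnorm g.
have hlin : linear (fun v => N^-1 * g v : R).
  by move=> a u v; rewrite linearP mulrDr; congr (_ + _); exact: mulrCA.
pose h : {linear X -> R} := 
  HB.pack (fun v => N^-1 * g v) (GRing.isLinear.Build R X R _ _ hlin).
have gh v : g v = N * h v by rewrite /= mulrA mulfV ?mul1r// gt_eqF.
have h1 v : `|h v| <= `|v|.
  rewrite -(ler_pM2l N0) -[X in X * `|h v|]gtr0_norm// -normrM -gh.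
  exact: contraction_opnorm.
exists h => //; split.
  move=> v; apply/cvgrPdist_lt => e e0.
  apply: filterS (nbhsx_ballx v e e0) => u; rewrite -ball_normE -linearB.
  exact: le_lt_trans (h1 _).
apply/eqP; rewrite eq_le; apply/andP; split.
  by apply: opnorm_le => v v1; rewrite (le_trans (h1 v)).
rewrite -(ler_pM2l N0) mulr1 -/N; apply: opnorm_le => v v1.
rewrite gh normrM gtr0_norm// ler_pM2l// (le_trans (contraction_opnorm h1 v))//.
by rewrite ler_piMr// opnorm_ge0.
Qed.

(** A short chord is harmless since [f] has norm one.  A long one is prolonged to
    the sphere by [extend_chord]: as [f] is affine on the chord and at most 1, a
    value near 1 at [p] forces one at the endpoint next to [p], then by
    hypothesis at the other endpoint, hence at [q]. *)
Lemma uacsed_ball (z : X) (e : R) : uacsed X -> z != 0 -> 0 < e ->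
  exists2 d : R, 0 < d & forall (p q : X) (f : {linear X -> R}),
    `|p| <= 1 -> `|q| <= 1 -> dual_sphere f ->
    (exists t, p - q = t *: z) -> 2 - d <= `|p + q| -> 1 - d <= f p ->
    1 - e < f q.
Proof.
move=> UX z0 e0; have [d d0 dP] := uacsed_modulus UX z0 e0.
(* The prolongation factor [c] of a chord longer than [e / 2] is below [4 / e];
   the bounds make [c * k] at most [d] and [e / 2]. *)
pose k := Num.min (e / 4) (Num.min (e * d / 4) (e * e / 8)).
have k0 : 0 < k by rewrite !lt_min !divr_gt0// mulr_gt0.
have [k1 k2 k3] : [/\ k <= e / 4, k <= e * d / 4 & k <= e * e / 8].
  by split; rewrite /k !ge_min lexx ?orbT.
exists k => // p q f p1 q1 f1 [t pqt] pq2 fp.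
have f1' := dual_sphere_le f1.
have [pqe|pqe] := leP `|p - q| (e / 2).
  have : `|f p - f q| <= e / 2 by rewrite -linearB (le_trans (f1' _)).
  rewrite ler_norml => /andP[_]; lra.
have pq : p != q.
  by rewrite -subr_eq0 -normr_gt0 (lt_trans _ pqe)// divr_gt0.
have [s [r /= [s0 r0 x1 y1 [pE qE xy xy2]]]] := extend_chord p1 q1 pq.
set x := p + _ in x1 xy xy2 pE qE; set y := q - _ in y1 xy xy2 pE qE.
have fpE : (1 + s + r) * f p = (1 + r) * f x + s * f y.
  by have := congr1 f pE; rewrite linearD !linearZ.
have fqE : (1 + s + r) * f q = r * f x + (1 + s) * f y.
  by have := congr1 f qE; rewrite linearD !linearZ.
have c2 : (1 + s + r) * `|p - q| <= 2.
  rewrite -[X in X * `|_|]ger0_norm ?addr_ge0// -normrZ -xy.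
  by rewrite (le_trans (ler_normB _ _))// x1 y1.
have {}xy : x - y = ((1 + s + r) * t) *: z by rewrite xy pqt scalerA.
move: xy xy2 fpE fqE c2.
have c1 : 1 <= 1 + s + r by lra.
have : s = (1 + s + r) - 1 - r by lra.
move: (1 + s + r) c1 => c c1 sE xy xy2 fpE fqE c2.
have ce : c * e <= 4 by nra.
have ck : c * k <= d by nra.
have ck' : c * k <= e / 2 by nra.
have fy1 : f y <= 1.
  by rewrite (le_trans (ler_norm _))// (le_trans (f1' _))// y1.
have fx : 1 - c * k <= f x.
  have : (1 + r) * (1 - f x) <= c * k by nra.
  have : 0 <= c * k by nra.
  move: (c * k) => m m0 fxm; nra.
have fy : 1 - e < f y.
  apply: (dP x y f) => //; last by lra.
  - by exists (c * t).
  - nra.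
have : c * (1 - e) < c * f q by rewrite fqE; nra.
by rewrite ltr_pM2l//; lra.
Qed.

(** This is the form in which one coordinate of an absolute sum meets the
    hypothesis.  Nothing is normalised: the vectors may be short and [g] may be
    small.  If the product of [opnorm g] and the larger norm of [p], [q] is at
    most [e / 2], the bound is trivial; otherwise both factors are at least
    [e / 2] and division by them leads to [uacsed_ball]. *)
Lemma uacsed_unnormalised (u : X) (e : R) : uacsed X -> 0 < e ->
  exists2 d : R, 0 < d & forall (p q : X) (g : {linear X -> R}),
    `|p| <= 1 -> `|q| <= 1 -> (forall v, `|g v| <= `|v|) ->
    (exists t, p - q = t *: u) ->
    `|p| <= `|p + q| / 2 + d -> `|q| <= `|p + q| / 2 + d ->
    (forall v, `|v| <= `|p| -> g v <= g p + d) ->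
    `|g (p - q)| <= e.
Proof.
move=> UX e0; have [->|u0] := eqVneq u 0.
  exists 1 => // p q g _ _ _ [t ->] _ _ _.
  by rewrite scaler0 linear0 normr0 ltW.
have [d d0 dP] := uacsed_ball UX u0 e0.
pose k := Num.min (e / 3) (e * d / 6).
have k0 : 0 < k by rewrite !lt_min !divr_gt0// mulr_gt0.
have [k1 k2] : k <= e / 3 /\ k <= e * d / 6.
  by split; rewrite /k !ge_min lexx ?orbT.
exists k => // p q g p1 q1 g1 [t pqt] pm qm gp.
have gN := contraction_opnorm g1.
set N := opnorm g in gN.
have N0 : 0 <= N by exact: opnorm_ge0.
have N1 : N <= 1 by apply: opnorm_le => v v1; exact: le_trans (g1 v) v1.
pose M := Num.max `|p| `|q|.
have pM : `|p| <= M by rewrite le_max lexx.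
have qM : `|q| <= M by rewrite le_max lexx orbT.
have M1 : M <= 1 by rewrite ge_max p1 q1.
have gpM : `|g p| <= N * M by rewrite (le_trans (gN p))// ler_wpM2l.
have gqM : `|g q| <= N * M by rewrite (le_trans (gN q))// ler_wpM2l.
have [NMe|NMe] := leP (N * M) (e / 2).
  rewrite linearB (le_trans (ler_normB _ _))//; lra.
have M0 : 0 <= M by rewrite le_max normr_ge0.
have Me : e / 2 < M by nra.
have Ne : e / 2 < N by nra.
have Mpos : 0 < M by lra.
have Npos : 0 < N by lra.
have Mm : M <= `|p + q| / 2 + k by rewrite ge_max pm qm.
have pM' : M - 2 * k <= `|p|.
  have := ler_normD p q; lra.
have NpM : N * `|p| <= g p + k.
  have [->|p0] := eqVneq p 0.
    by rewrite normr0 mulr0 linear0 add0r ltW.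
  have np0 : 0 < `|p| by rewrite normr_gt0.
  rewrite -ler_pdivlMr//; apply: opnorm_le => v v1.
  have scaled (w : X) : `|w| <= 1 -> `|p| * g w <= g p + k.
    move=> w1; have := gp (`|p| *: w); rewrite linearZ; apply.
    by rewrite normrZ normr_id ler_piMr.
  rewrite ler_norml ler_pdivlMr// [g v * _]mulrC scaled// andbT.
  have := scaled (- v); rewrite normrN linearN mulrN => /(_ v1) gv.
  by rewrite lerNl ler_pdivlMr// mulNr mulrC.
have gpNM : N * M - 3 * k <= g p by nra.
have [h h1 gh] := normalise_dual g1 Npos.
have hq : 1 - e < h (M^-1 *: q).
  apply: (dP (M^-1 *: p)) => //.
  - by rewrite normrZ gtr0_norm ?invr_gt0// mulrC ler_pdivrMr// mul1r.
  - by rewrite normrZ gtr0_norm ?invr_gt0// mulrC ler_pdivrMr// mul1r.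
  - by exists (M^-1 * t); rewrite -scalerBr pqt scalerA.
  - rewrite -scalerDr normrZ gtr0_norm ?invr_gt0// [leRHS]mulrC.
    rewrite ler_pdivlMr//; nra.
  - rewrite linearZ /= [leRHS]mulrC ler_pdivlMr// -(ler_pM2l Npos) -gh; nra.
move: hq; rewrite linearZ /= -[M^-1 *: _]/(M^-1 * _) [ltRHS]mulrC.
rewrite ltr_pdivlMr// -(ltr_pM2l Npos) -gh => hq.
move: gpM gqM; rewrite linearB /= !ler_norml => /andP[_ ?] /andP[_ ?].
have NM1 : N * M <= 1 by nra.
apply/andP; split; nra.
Qed.
End functionals.

(** * Absolute sums *)

Section absolute_sums.
Variables (R : realType) (I : Type) (E : abs_norm_space R I).
Variable X : I -> completeNormedModType R.

(** The family supported at [i]; the transport along [i = j] moves [v] to the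
    type of the [j]-th coordinate. *)
Definition single_fun (i : I) (v : X i) : dprod X := fun j =>
  if pselect (i = j) is left ij then eq_rect i X v j ij else 0.

Lemma single_funE i (v : X i) : single_fun v i = v.
Proof.
rewrite /single_fun; case: pselect => // ii.
by rewrite (Prop_irrelevance ii erefl).
Qed.

Lemma single_fun_neq i j (v : X i) : i <> j -> single_fun v j = 0.
Proof. by move=> ij; rewrite /single_fun; case: pselect. Qed.

Lemma norms_single i (v : X i) :
  norms (single_fun v) = nsval (`|v| *: delta E i).
Proof.
apply/funext => j; rewrite -[RHS]/(`|v| * \1_[set i] j) indicE /norms.
have [<-|ij] := pselect (i = j); first by rewrite single_funE mem_set// mulr1.
by rewrite single_fun_neq// normr0 memNset ?mulr0// => /esym.
Qed.

Lemma single_subproof i (v : X i) : single_fun v \in abs_sum_carrier (X := X) E.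
Proof. by rewrite /abs_sum_carrier unfold_in norms_single; exact: valP. Qed.

Definition single i (v : X i) : abs_sum E X := AbsSum (single_subproof v).

Lemma single_is_linear i : linear (@single i).
Proof.
move=> a u v; apply/val_inj/functional_extensionality_dep => j.
rewrite -[RHS]/(a *: single_fun u j + single_fun v j) /=.
have [<-|ij] := pselect (i = j); first by rewrite !single_funE.
by rewrite !single_fun_neq// scaler0 addr0.
Qed.

HB.instance Definition _ i :=
  GRing.isLinear.Build R (X i) (abs_sum E X) _ (@single i) (@single_is_linear i).

Lemma norm_single i (v : X i) : `|single v| = `|v|.
Proof.
rewrite abs_sum_normE -/(norms _) norms_single.
by rewrite -[LHS]/(`| `|v| *: delta E i|) normrZ normr_id
  [X in _ * X](ans_normalised E i) mulr1.
Qed.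

Definition norm_family (x : abs_sum E X) : anstype E := NSType (valP x).

Lemma norm_norm_family x : `|norm_family x| = `|x|.
Proof. by []. Qed.

Lemma abs_sum_dominated (x : abs_sum E X) (a : anstype E) :
  (forall i, `|asval x i| <= `|nsval a i|) -> `|x| <= `|a|.
Proof.
by move=> xa; apply: (ans_dominated (b := a) _).2 => i; rewrite normr_id.
Qed.

Lemma norm_asval_le (x : abs_sum E X) i : `|asval x i| <= `|x|.
Proof.
by have := ans_coord_le (norm_family x) i; rewrite [X in X <= _]normr_id.
Qed.

Lemma asval_sum (J : Type) (s : seq J) (x : J -> abs_sum E X) i :
  asval (\sum_(j <- s) x j) i = \sum_(j <- s) asval (x j) i.
Proof. exact: (big_morph (fun y : abs_sum E X => asval y i)). Qed.

Hypothesis spanE : dense (lin_span (range (delta E))).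

(** The list is made duplicate free, since repeated indices would count a
    coordinate of [z] several times. *)
Lemma finite_sections (z : abs_sum E X) (e : R) : 0 < e ->
  exists s : seq {classic I},
    `|z - \sum_(i <- s) single (asval z i)| < e.
Proof.
move=> e0; have [s sP] := ans_small_tail spanE (norm_family z) e0.
exists (undup s); set y := z - _.
have yE j : asval y j = if (j : {classic I}) \in s then 0 else asval z j.
  rewrite -[LHS]/(asval z j - asval _ j) asval_sum.
  have [js|js] := boolP ((j : {classic I}) \in s).
    have ju : (j : {classic I}) \in undup s by rewrite mem_undup.
    rewrite (big_rem _ ju) /= single_funE big1_seq ?addr0 ?subrr// => i /=.
    rewrite mem_rem_uniq ?undup_uniq// inE => /andP[/eqP ij _].
    by rewrite single_fun_neq.
  rewrite big1_seq ?subr0// => i /=; rewrite mem_undup => si.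
  by rewrite single_fun_neq// => ij; move: js; rewrite -ij si.
move: y yE => y yE.
rewrite -norm_norm_family; apply: sP => [i|i si] /=; rewrite /norms yE.
  by case: ifP => _; rewrite ?normr0 ?normr_id.
by rewrite si normr0.
Qed.

Hypothesis UE : URED (anstype E).

(** The families of norms of [x] and of the midpoint [m] satisfy the assumptions
    of [URED_order_interval] because [x + m] is nearly extremal along with
    [x + y].  Comparing [x] with [m] rather than with [y] shows at once that the
    coordinates of [x] and [y] have almost equal norms and that their sum is
    almost as long as possible. *)
Lemma coordinate_midpoints (w : abs_sum E X) (e : R) : 0 < e ->
  exists2 d : R, 0 < d & forall x y : abs_sum E X, `|x| <= 1 -> `|y| <= 1 ->
    (forall i, `|asval x i - asval y i| <= `|asval w i|) ->
    2 - d <= `|x + y| ->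
    forall i, `|asval x i| <= `|asval x i + asval y i| / 2 + e.
Proof.
move=> e0; have [d d0 dP] := URED_order_interval spanE (norm_family w) UE e0.
exists (d / 2) => [|x y x1 y1 xyw xy2 i]; first exact: divr_gt0.
pose m := 2^-1 *: (x + y).
have mE j : asval m j = 2^-1 *: (asval x j + asval y j) by [].
have m1 : `|m| <= 1.
  by rewrite normrZ ger0_norm ?invr_ge0// ler_pdivrMl// mulr1
    (le_trans (ler_normD _ _))//; lra.
have xm : x + m = (3 / 2) *: (x + y) - y.
  have -> : 3 / 2 = 1 + 2^-1 :> R by lra.
  by rewrite scalerDl scale1r -/m addrAC addrK.
have xm2 : 2 - d <= `|norm_family x + norm_family m|.
  apply: (@le_trans _ _ `|x + m|).
    rewrite xm (le_trans _ (lerB_dist _ _))// normrZ ger0_norm//; lra.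
  apply: abs_sum_dominated => j; rewrite (le_trans (ler_normD _ _))//.
  exact: ler_norm.
have : `|norm_family x - norm_family m| < e.
  apply: dP => // j /=; rewrite normr_id /norms.
  apply: le_trans (ler_dist_dist _ _) _; apply: le_trans (xyw j).
  have -> : asval x j - asval m j = 2^-1 *: (asval x j - asval y j).
    have {1}-> : asval x j = 2^-1 *: asval x j + 2^-1 *: asval x j.
      by rewrite -scalerDl -[LHS]scale1r; congr (_ *: _); lra.
    by rewrite mE scalerBr scalerDr opprD addrACA subrr add0r.
  rewrite normrZ ger0_norm ?invr_ge0// ler_piMl//; lra.
move=> /ltW /(le_trans (ans_coord_le _ i)).
rewrite -[nsval _ i]/(`|asval x i| - `|asval m i|) mE normrZ.
by rewrite ger0_norm ?invr_ge0// ler_norml => /andP[_]; lra.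
Qed.

(** The hypotheses of uacsed with defect [d], together with a bound [C] on the
    multiple of [z]; the estimates below are uniform over all such data. *)
Definition extremal_chord (z : abs_sum E X) (C d : R) (x y : abs_sum E X)
    (f : {linear abs_sum E X -> R}) (t : R) : Prop :=
  [/\ `|x| <= 1, `|y| <= 1, forall v, `|f v| <= `|v|, x - y = t *: z &
   [/\ `|t| <= C, 2 - d <= `|x + y| & 1 - d <= f x]].

Lemma extremal_chord_le z C d d' x y f t : d <= d' ->
  extremal_chord z C d x y f t -> extremal_chord z C d' x y f t.
Proof.
by move=> dd [? ? ? ? [? ? ?]]; split => //; split => //; lra.
Qed.

Hypothesis UX : forall i, uacsed (X i).

(** The functional [f] restricted to the [i]-th coordinate nearly attains its
    norm at [asval x i] by an exchange of coordinates, and the norms are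
    controlled by [coordinate_midpoints]. *)
Lemma uacsed_coordinate (z : abs_sum E X) (C e : R) (i : I) : 0 <= C -> 0 < e ->
  exists2 d : R, 0 < d & forall x y f t, extremal_chord z C d x y f t ->
    `|t * f (single (asval z i))| <= e.
Proof.
move=> C0 e0; have [d1 d10 d1P] := uacsed_unnormalised (asval z i) (@UX i) e0.
have [d2 d20 d2P] := coordinate_midpoints (C *: z) d10.
exists (Num.min d1 d2) => [|x y f t [x1 y1 f1 xyz [tC xy2 fx]]].
  by rewrite lt_min d10.
have md1 : Num.min d1 d2 <= d1 by rewrite ge_min lexx.
have md2 : Num.min d1 d2 <= d2 by rewrite ge_min lexx orbT.
have xyE j : asval x j - asval y j = t *: asval z j.
  by rewrite -[LHS]/(asval (x - y) j) xyz.
have xyw j : `|asval x j - asval y j| <= `|asval (C *: z) j|.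
  rewrite xyE -[asval (C *: z) j]/(C *: asval z j) !normrZ.
  by rewrite ler_wpM2r// (ger0_norm C0).
pose g : {linear X i -> R} := f \o @single i.
have -> : t * f (single (asval z i)) = g (asval x i - asval y i).
  by rewrite xyE linearZ.
apply: d1P.
- by rewrite (le_trans (norm_asval_le _ _)).
- by rewrite (le_trans (norm_asval_le _ _)).
- by move=> v; rewrite (le_trans (f1 _))// norm_single.
- by exists t; rewrite xyE.
- by apply: d2P => //; lra.
- rewrite [asval x i + _]addrC; apply: d2P => // [j|].
    by rewrite distrC.
  by rewrite [y + x]addrC; lra.
move=> v vx.
(* Exchanging the [i]-th coordinate of [x] for [v] does not increase its norm. *)
pose x' := x - single (asval x i) + single v.
have x'1 : `|x'| <= 1.
  apply: le_trans x1; apply: (abs_sum_dominated (a := norm_family x)) => j.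
  rewrite -[asval x' j]/(asval x j - single_fun (asval x i) j + single_fun v j).
  rewrite /= [leRHS]normr_id /norms.
  have [<-|ij] := pselect (i = j); first by rewrite !single_funE subrr add0r.
  by rewrite !single_fun_neq// subr0 addr0.
have : f x' <= 1 by rewrite (le_trans (ler_norm _))// (le_trans (f1 _)).
rewrite /x' linearD linearB /=; lra.
Qed.

Lemma uacsed_finite (z : abs_sum E X) (C e : R) (s : seq I) : 0 <= C -> 0 < e ->
  exists2 d : R, 0 < d & forall x y f t, extremal_chord z C d x y f t ->
    `|t * f (\sum_(i <- s) single (asval z i))| <= e.
Proof.
move=> C0; elim: s e => [|i s IH] e e0.
  by exists 1 => // x y f t _; rewrite big_nil linear0 mulr0 normr0 ltW.
have e2 : 0 < e / 2 by rewrite divr_gt0.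
have [d1 d10 d1P] := uacsed_coordinate z i C0 e2.
have [d2 d20 d2P] := IH _ e2.
exists (Num.min d1 d2) => [|x y f t chord]; first by rewrite lt_min d10.
rewrite big_cons linearD mulrDr (le_trans (ler_normD _ _))//.
have /d1P : extremal_chord z C d1 x y f t.
  by apply: extremal_chord_le chord; rewrite ge_min lexx.
have /d2P : extremal_chord z C d2 x y f t.
  by apply: extremal_chord_le chord; rewrite ge_min lexx orbT.
lra.
Qed.

(** The part of [z] outside finitely many coordinates is negligible, uniformly in
    [f] and [t]. *)
Lemma uacsed_extremal_chord (z : abs_sum E X) (C e : R) : 0 < C -> 0 < e ->
  exists2 d : R, 0 < d & forall x y f t, extremal_chord z C d x y f t ->
    `|t * f z| <= e.
Proof.
move=> C0 e0; have e2 : 0 < e / 2 by rewrite divr_gt0.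
have [s sP] := finite_sections z (divr_gt0 e2 C0).
have [d d0 dP] := uacsed_finite z s (ltW C0) e2.
exists d => // x y f t chord; have [_ _ f1 _ [tC _ _]] := chord.
move: sP; set zs := \sum_(i <- s) _ => sP.
rewrite -(subrK zs z) linearD mulrDr (le_trans (ler_normD _ _))//.
have : `|t * f (z - zs)| <= e / 2.
  rewrite normrM (@le_trans _ _ (C * (e / 2 / C)))//.
    by rewrite ler_pM// (le_trans (f1 _))// ltW.
  by rewrite mulrC divfK// gt_eqF.
have := dP _ _ _ _ chord; rewrite -/zs; lra.
Qed.

End absolute_sums.

Theorem theorem5p5 (R : realType) (I : Type) (E : abs_norm_space R I)
    (X : I -> completeNormedModType R) :
  inhabited I ->
  dense (lin_span (range (delta E))) ->
  URED (anstype E) ->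
  (forall i, uacsed (X i)) ->
  uacsed (abs_sum E X).
Proof.
move=> _ spanE UE UX z x y f z0 x1 y1 f1 xy2 fx1 xyz.
have nz0 : 0 < `|z| by rewrite normr_gt0.
have /choice[t tP] n : exists t, x n - y n = t *: z by exact/lin_span1.
suff tf0 : t n * f n z @[n --> \oo] --> (0 : R).
  have -> : (fun n => f n (y n)) = (fun n => f n (x n) - t n * f n z).
    apply/funext => n; rewrite -[y n](subKr (x n)) tP linearB linearZ /=.
    by [].
  by rewrite -[X in _ --> X]subr0; exact: cvgB.
apply/cvgrPdist_le => e e0.
have C0 : 0 < 2 / `|z| by rewrite divr_gt0.
have [d d0 dP] := uacsed_extremal_chord spanE UE UX z C0 e0.
near=> n; rewrite sub0r normrN; apply: (dP (x n) (y n)); split.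
- by rewrite x1.
- by rewrite y1.
- exact: dual_sphere_le.
- exact: tP.
split.
- rewrite ler_pdivlMr// -normrZ -tP (le_trans (ler_normB _ _))// x1 y1; lra.
- near: n; apply: (cvgr_ge (2 : R)) xy2 _ _; lra.
- near: n; apply: (cvgr_ge (1 : R)) fx1 _ _; lra.
Unshelve. all: by end_near. Qed.
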